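(* Let $(X,d)$ be a metric space, let $f,g:X\to X$ be self-mappings, and let $f$ be a Suzuki type generalized $(Z_G,g)$-contraction. Assume that (i) $f(X)\subseteq g(X)$, and (ii) $g(X)$ or $f(X)$ is complete (as a metric subspace of $X$). Then $f$ and $g$ have a unique point of coincidence, i.e. there is exactly one $u\in X$ for which there exists $v\in X$ with $u=fv=gv$.
   Context: Metric spaces are assumed nonempty. A $C$-class function is a continuous map $G:[0,\infty)^2\to\mathbb{R}$ such that for all $s,t\in[0,\infty)$: $G(s,t)\le s$; and $G(s,t)=s$ implies $s=0$ or $t=0$. A map $G:[0,\infty)^2\to\mathbb{R}$ has property $C_G$ if there is a constant $C_G\ge 0$ such that (i) $G(s,t)>C_G$ implies $s>t$; (ii) $G(t,t)\le C_G$ for all $t\in[0,\infty)$. Fix a $C$-class function $G$ with property $C_G$, and fix the corresponding constant $C_G\ge 0$. A $C_G$-simulation function is a map $\zeta:[0,\infty)^2\to\mathbb{R}$ such that: (a) $\zeta(t,s)<G(s,t)$ for all $t,s>0$; (b) if $\{t_n\},\{s_n\}$ are sequences in $(0,\infty)$ with $\lim_{n\to\infty}t_n=\lim_{n\to\infty}s_n>0$ and $t_n<s_n$ for all $n$, then $\limsup_{n\to\infty}\zeta(t_n,s_n)<C_G$. $Z_G$ denotes the family of all $C_G$-simulation functions. For self-mappings $f,g$ of a metric space $(X,d)$, put $$M(x,y)=\max\left\{d(gx,gy),\,d(gx,fx),\,d(gy,fy),\,\frac{d(gx,fy)+d(gy,fx)}{2}\right\}.$$ The mapping $f$ is a Suzuki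 type generalized $(Z_G,g)$-contraction if there exists $\zeta\in Z_G$ such that for all $x,y\in X$ with $gx\ne gy$: $$\tfrac12 d(gx,fx)<d(gx,gy)\ \Longrightarrow\ \zeta\big(d(fx,fy),M(x,y)\big)\ge C_G.$$ A point $u\in X$ is a point of coincidence of $f$ and $g$ if $u=fv=gv$ for some $v\in X$. *)

(* Defs.v *)
From HB Require Import structures.
From mathcomp Require Import all_boot all_order all_algebra.
From mathcomp Require Import all_classical all_reals all_analysis.

Set Implicit Arguments.
Unset Strict Implicit.
Unset Printing Implicit Defensive.

Import Order.TTheory GRing.Theory Num.Theory.
Import numFieldNormedType.Exports.

Local Open Scope classical_set_scope.
Local Open Scope ring_scope.

(* Real functions on [0,oo)^2 are represented by total functions R -> R -> R of
   which only the restriction to the closed quadrant is ever constrained or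
   used; values elsewhere are irrelevant. *)
Definition quadrant (R : realType) : set (R * R) :=
  [set p | 0 <= p.1 /\ 0 <= p.2].
Arguments quadrant R : clear implicits.

Definition C_class (R : realType) (G : R -> R -> R) : Prop :=
  [/\ {within quadrant R, continuous (fun p : R * R => G p.1 p.2)},
      forall s t, 0 <= s -> 0 <= t -> G s t <= s &
      forall s t, 0 <= s -> 0 <= t -> G s t = s -> s = 0 \/ t = 0].

Definition property_CG (R : realType) (G : R -> R -> R) (C : R) : Prop :=
  [/\ 0 <= C,
      forall s t, 0 <= s -> 0 <= t -> C < G s t -> t < s &
      forall t, 0 <= t -> G t t <= C].

(* The limsup is taken in the extended reals: zeta (t n) (s n) is bounded above
   but need not be bounded below, so its limsup may be -oo. *)
Definition CG_simulation (R : realType) (G : R -> R -> R) (C : R)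
    : set (R -> R -> R) :=
  [set zeta : R -> R -> R |
     (forall t s, 0 < t -> 0 < s -> zeta t s < G s t) /\
     (forall (t s : nat -> R) (l : R),
        (forall n, 0 < t n) -> (forall n, 0 < s n) ->
        t @ \oo --> l -> s @ \oo --> l -> 0 < l ->
        (forall n, t n < s n) ->
        (limn_esup (fun n => (zeta (t n) (s n))%:E) < C%:E)%E)].

Definition M_max (R : realType) (X : metricType R) (f g : X -> X) (x y : X) : R :=
  Num.max (mdist (g x) (g y))
    (Num.max (mdist (g x) (f x))
      (Num.max (mdist (g y) (f y))
        ((mdist (g x) (f y) + mdist (g y) (f x)) / 2))).

Definition Suzuki_generalized_contraction (R : realType) (G : R -> R -> R)
    (C : R) (X : metricType R) (f g : X -> X) : Prop :=
  exists2 zeta, CG_simulation G C zeta &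
    forall x y, g x <> g y ->
      2^-1 * mdist (g x) (f x) < mdist (g x) (g y) ->
      C <= zeta (mdist (f x) (f y)) (M_max f g x y).

Definition complete_subspace (R : realType) (X : metricType R) (A : set X)
    : Prop :=
  forall u : nat -> X, (forall n, A (u n)) -> cauchy (u @ \oo) ->
    exists2 l, A l & u @ \oo --> l.

Definition point_of_coincidence (X : Type) (f g : X -> X) (u : X) : Prop :=
  exists v, u = f v /\ u = g v.

(* Main.v *)
Require Import Defs.
From HB Require Import structures.
From mathcomp Require Import all_boot all_order all_algebra.
From mathcomp Require Import all_classical all_reals all_analysis.
From mathcomp Require Import lra.
Import Order.TTheory GRing.Theory Num.Theory.
Import numFieldNormedType.Exports.
Local Open Scope classical_set_scope.
Local Open Scope ring_scope.

(** The theorem is a Jungck-type fixed point theorem.  Two consequences of the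
    simulation-function axioms carry it, after which [G] and [zeta] are never
    mentioned again.

    - If [C <= zeta t s] with [t] and [s] positive, then [C < G s t], so that
      [t < s] by property [C_G].
    - For each [l > 0], the inequality [C <= zeta t s] fails for all [t] and [s]
      close enough to [l]: a sequence of counterexamples converging to [(l, l)]
      would satisfy [t n < s n] by the first point, and the values of [zeta]
      along it would have limsup at least [C], against axiom (b).

    Hence [d (f x) (f y) < M x y] at every pair satisfying the Suzuki condition,
    and at such pairs the two sides cannot both be close to one and the same
    [l > 0] ([gap_contraction]).  This is a Meir-Keeler-like condition, and each
    step of the existence proof contradicts it for a well-chosen [l].

    Since [f(X)] is included in [g(X)], there is a sequence [x] with
    [y n := f (x n) = g (x n.+1)].  If [y n = y n.+1] for some [n], this value is
    a point of coincidence.  Otherwise the steps [d (y n) (y n.+1)] decrease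
    strictly, and a positive limit [l] of the steps is excluded by the gap
    ([orbit_step_small]).  If [y] were not Cauchy, then at the first index where
    the orbit leaves an [e]-ball around some late [y m], all the distances that
    matter would be close to [l = e] ([orbit_cauchy_mdist]).  So [y] converges to
    some [g v]; the pair [(x n.+1, v)] satisfies the Suzuki condition for
    arbitrarily large [n], and [f v <> g v] would make both sides of the
    contraction tend to [l = d (g v) (f v)] ([orbit_lim_coincidence]).

    For uniqueness, at two coincidence points [M] reduces to the distance
    between the two values, which would be strictly smaller than itself. *)

(** * Real sequences *)

Lemma limn_esup_ge (R : realType) (u : nat -> \bar R) (c : \bar R) :
  (forall n, (c <= u n)%E) -> (c <= limn_esup u)%E.
Proof.
move=> cu; rewrite leNgt; apply/negP => ltc.
have ucvg := limn_esup_le_cvg (ltW ltc) cu.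
by move: ltc; rewrite (cvg_limn_einf_sup ucvg).2 ltxx.
Qed.

Lemma exists_quarter_le {R : realType} {a b : R} : 0 < a -> 0 < b ->
  exists eta : R, [/\ 0 < eta, 4 * eta <= a & 4 * eta <= b].
Proof.
move=> a0 b0; exists (Num.min a b / 4).
have : Num.min a b <= a by rewrite ge_min lexx.
have : Num.min a b <= b by rewrite ge_min lexx orbT.
have : 0 < Num.min a b by rewrite lt_min a0.
by split; lra.
Qed.

Lemma cvg_squeeze_harmonic (R : realType) (l : R) (u : nat -> R) :
  (forall n, `|u n - l| < n.+1%:R^-1) -> u @ \oo --> l.
Proof.
move=> ul; apply/cvgrPdist_lt => e e0.
have [N _ HN] := near_infty_natSinv_lt (PosNum e0).
by exists N => // n Nn /=; rewrite distrC; exact: lt_trans (ul n) (HN n Nn).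
Qed.

(** * Simulation functions *)

Section simulation_functions.
Context {R : realType} {G zeta : R -> R -> R} {C : R}.

Lemma CG_simulation_lt (GC : property_CG G C) (sim : CG_simulation G C zeta)
    {t s : R} :
  0 < t -> 0 < s -> C <= zeta t s -> t < s.
Proof.
case: GC sim => _ GC _ [zetaG _] t0 s0 Cz.
by apply: GC; [exact: ltW..|exact: le_lt_trans Cz (zetaG _ _ t0 s0)].
Qed.

(** Axiom (b) in pointwise form.  The neighbourhood of [(l, l)] comes without
    the restriction [t < s], since [C <= zeta t s] already forces it. *)
Lemma CG_simulation_gap (GC : property_CG G C) (sim : CG_simulation G C zeta)
    {l : R} :
  0 < l -> exists2 delta : R, 0 < delta &
    forall t s, `|t - l| < delta -> `|s - l| < delta -> zeta t s < C.
Proof.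
move=> l0; apply: contrapT => nodelta.
have bad n : exists p : R * R, [/\ 0 < p.1, 0 < p.2,
    `|p.1 - l| < n.+1%:R^-1, `|p.2 - l| < n.+1%:R^-1 & C <= zeta p.1 p.2].
  apply: contrapT => nop; apply: nodelta.
  (* The bound by [l] keeps both arguments positive. *)
  exists (Num.min l n.+1%:R^-1) => [|t s].
    by rewrite lt_min l0 invr_gt0 ltr0n.
  rewrite !lt_min => /andP[tl tn] /andP[sl sn].
  rewrite ltNge; apply/negP => Cz; apply: nop; exists (t, s) => /=.
  by split => //; move: tl sl; rewrite !ltr_norml => *; lra.
have [p pP] := choice bad.
have [_ simlim] := sim.
have := simlim (fun n => (p n).1) (fun n => (p n).2) l.
have H1 n : 0 < (p n).1 by case: (pP n).
have H2 n : 0 < (p n).2 by case: (pP n).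
have H3 n : C <= zeta (p n).1 (p n).2 by case: (pP n).
have c1 : (fun n => (p n).1) @ \oo --> l.
  by apply: cvg_squeeze_harmonic => n; case: (pP n).
have c2 : (fun n => (p n).2) @ \oo --> l.
  by apply: cvg_squeeze_harmonic => n; case: (pP n).
have H4 n : (p n).1 < (p n).2.
  by have := CG_simulation_lt GC sim (H1 n) (H2 n) (H3 n).
move=> /(_ H1 H2 c1 c2 l0 H4).
by apply/negP; rewrite -leNgt; apply: limn_esup_ge => n; rewrite lee_fin.
Qed.

End simulation_functions.

(** * Gap contractions *)

Section gap_contractions.
Context {R : realType} {X : metricType R}.
Implicit Types (f g : X -> X) (x y : X).

Definition Suzuki_pair f g x y :=
  g x <> g y /\ 2^-1 * mdist (g x) (f x) < mdist (g x) (g y).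

(** The second clause excludes the limiting case of the first: along pairs
    satisfying the Suzuki condition, [mdist (f x) (f y)] and [M_max f g x y]
    cannot approach a common positive limit. *)
Definition gap_contraction f g :=
  (forall x y, Suzuki_pair f g x y -> mdist (f x) (f y) < M_max f g x y) /\
  (forall l, 0 < l -> exists2 delta : R, 0 < delta &
    forall x y, Suzuki_pair f g x y ->
      `|mdist (f x) (f y) - l| < delta -> `|M_max f g x y - l| < delta ->
      False).

Lemma mdist_neq_gt0 {x y} : x <> y -> 0 < mdist x y.
Proof. by move=> /eqP; rewrite mdist_gt0. Qed.

Lemma M_max_lt f g x y (b : R) :
  M_max f g x y < b <->
  [/\ mdist (g x) (g y) < b, mdist (g x) (f x) < b, mdist (g y) (f y) < b &
      (mdist (g x) (f y) + mdist (g y) (f x)) / 2 < b].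
Proof. by rewrite /M_max !gt_max; split => [/and4P[]|[-> -> -> ->]]. Qed.

Lemma M_max_ge_g f g x y : mdist (g x) (g y) <= M_max f g x y.
Proof. by rewrite /M_max le_max lexx. Qed.

Lemma M_max_ge_gf f g x y : mdist (g y) (f y) <= M_max f g x y.
Proof. by rewrite /M_max !le_max lexx !orbT. Qed.

Lemma Suzuki_gap_contraction {G : R -> R -> R} {C : R} {f g} :
  property_CG G C -> Suzuki_generalized_contraction G C f g ->
  gap_contraction f g.
Proof.
move=> GC [zeta sim contr]; split=> [x y [gxy half]|l l0].
  have M0 : 0 < M_max f g x y.
    exact: lt_le_trans (mdist_neq_gt0 gxy) (M_max_ge_g _ _ _ _).
  have [->|/mdist_neq_gt0 fxy] := pselect (f x = f y); first by rewrite mdistxx.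
  by have := CG_simulation_lt GC sim fxy M0 (contr _ _ gxy half).
have [delta delta0 gap] := CG_simulation_gap GC sim l0.
exists delta => // x y [gxy half] fl Ml.
by have := contr _ _ gxy half; rewrite leNgt gap.
Qed.

(** The pair [(u, v)] satisfies the Suzuki condition because [d (g u) (f u) = 0],
    and [M_max f g u v] collapses to [d (g u) (g v) = d (f u) (f v)]. *)
Lemma coincidence_value_unique {f g u v} :
  gap_contraction f g -> f u = g u -> f v = g v -> g u = g v.
Proof.
move=> [lt_M _] fu fv; apply: contrapT => guv.
have d0 := mdist_neq_gt0 guv.
have /lt_M : Suzuki_pair f g u v by split; rewrite ?fu ?mdistxx ?mulr0.
suff : ~ mdist (g u) (g v) < M_max f g u v by rewrite fu fv.
apply/negP; rewrite -leNgt /M_max fu fv !mdistxx (metric_sym (g v)) !ge_max.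
by apply/and4P; split; lra.
Qed.

End gap_contractions.

(** * The Jungck orbit *)

Section Jungck_orbit.
Context {R : realType} {X : metricType R} {f g : X -> X} {x : nat -> X}.
Context (contr : gap_contraction f g).
Context (fg : forall n, f (x n) = g (x n.+1)).
Context (neq : forall n, f (x n) <> f (x n.+1)).

Let y n := f (x n).
Let d n := mdist (y n) (y n.+1).

Let d_gt0 n : 0 < d n. Proof. exact/mdist_neq_gt0/neq. Qed.

Let orbit_Suzuki_pair m n : y m <> y n -> d m < 2 * mdist (y m) (y n) ->
  Suzuki_pair f g (x m.+1) (x n.+1).
Proof.
move=> ymn dm; split; rewrite -!fg //.
rewrite -[mdist (f (x m)) (f (x m.+1))]/(d m).
rewrite -[mdist (f (x m)) (f (x n))]/(mdist (y m) (y n)); lra.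
Qed.

Let consecutive_Suzuki_pair n : Suzuki_pair f g (x n.+1) (x n.+2).
Proof.
apply: orbit_Suzuki_pair; first exact: neq.
by have := d_gt0 n; rewrite -/(d n); lra.
Qed.

(** The mixed term of [M_max] is at most the average of two consecutive steps,
    because one of its two distances vanishes. *)
Lemma orbit_M_max_lt (b : R) n : d n < b -> d n.+1 < b ->
  M_max f g (x n.+1) (x n.+2) < b.
Proof.
move=> dn dn1; apply/M_max_lt; rewrite -!fg; split => //.
rewrite mdistxx addr0.
have := metric_triangle (y n) (y n.+1) (y n.+2).
by move: dn dn1; rewrite /d /y; lra.
Qed.

(** If [d n <= d n.+1], then [M_max] at the pair [(x n.+1, x n.+2)] would be at
    most [d n.+1], which is the distance that it strictly bounds. *)
Lemma orbit_step_decreasing n : d n.+1 < d n.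
Proof.
have := contr.1 _ _ (consecutive_Suzuki_pair n).
rewrite -[mdist _ _]/(d n.+1) => ltM.
have [//|le_d] := ltP (d n.+1) (d n).
suff : M_max f g (x n.+1) (x n.+2) <= d n.+1 by rewrite leNgt ltM.
apply/ler_addgt0Pr => e e0; apply/ltW/orbit_M_max_lt; lra.
Qed.

Lemma orbit_step_nonincreasing {m n} : (m <= n)%N -> d n <= d m.
Proof.
move=> mn; rewrite -(subnK mn); elim: (n - m)%N => [|k IH] //.
exact: le_trans (ltW (orbit_step_decreasing _)) IH.
Qed.

(** The steps decrease to their infimum [r].  If [r > 0], a step within the gap
    width of [r], together with the following one, violates the gap at [r]. *)
Lemma orbit_step_small {e : R} : 0 < e ->
  exists N, forall n, (N <= n)%N -> d n < e.
Proof.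
move=> e0; set r := inf (range d).
have dinf : has_inf (range d).
  by split; [exists (d 0%N), 0%N|exists 0 => _ [n _ <-]; exact/ltW].
have r_le n : r <= d n by apply: ge_inf; [exact: dinf.2|exists n].
have [N dN] : exists N, d N < e.
  have [r0|r0] := leP r 0.
    have [_ [N _ <-] dN] := inf_adherent e0 dinf.
    by exists N; rewrite -/r in dN; lra.
  have [delta delta0 gap] := contr.2 r r0.
  have [_ [n _ <-]] := inf_adherent delta0 dinf; rewrite -/r => dn.
  exfalso; apply: (gap _ _ (consecutive_Suzuki_pair n)).
    rewrite -[mdist _ _]/(d n.+1).
    have := r_le n.+1; have := orbit_step_decreasing n.
    by rewrite ltr_norml => *; lra.
  have := M_max_ge_g f g (x n.+1) (x n.+2).
  rewrite -!fg -[mdist _ _]/(d n) => dM.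
  have : M_max f g (x n.+1) (x n.+2) < r + delta.
    by apply: orbit_M_max_lt => //; have := orbit_step_decreasing n; lra.
  by have := r_le n; rewrite ltr_norml => *; lra.
by exists N => n /orbit_step_nonincreasing; move: dN; lra.
Qed.

(** Let [delta] be the gap width at [e].  Steps are eventually shorter than
    [delta / 4]: the two distances below differ by at most two steps from
    [d (y m) (y n.+1)], and that one by at most one step from [e].  By induction on [k], the orbit cannot leave the [e]-ball around [y m]: on the
    first exit, at index [n.+1], the distance [d (y m) (y n.+1)] would exceed [e]
    by less than one step, so that [d (y m.+1) (y n.+2)] and [M_max] would both
    be within [delta] of [e]. *)
Lemma orbit_cauchy_mdist {e : R} : 0 < e ->
  exists N, forall m n, (N <= m)%N -> (N <= n)%N -> mdist (y m) (y n) < e.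
Proof.
move=> e0; have [delta delta0 gap] := contr.2 e e0.
have [eta [eta0 eta_e eta_delta]] := exists_quarter_le e0 delta0.
have [N dN] := orbit_step_small eta0.
suff close m k : (N <= m)%N -> mdist (y m) (y (m + k)%N) < e.
  exists N => m n Nm Nn; have [mn|/ltnW nm] := leqP m n.
    by rewrite -(subnKC mn) close.
  by rewrite metric_sym -(subnKC nm) close.
move=> Nm; elim: k => [|k IH]; first by rewrite addn0 mdistxx.
rewrite addnS ltNge; apply/negP => far.
set n := (m + k)%N in IH far.
have [dm dn] : d m < eta /\ d n < eta.
  by split; apply: dN => //; rewrite (leq_trans Nm) ?leq_addr.
have dn1 : d n.+1 < eta by have := orbit_step_decreasing n; lra.
have dm1 : d m.+1 < eta by have := orbit_step_decreasing m; lra.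
have T1 := metric_triangle (y m) (y n) (y n.+1).
have T2 := metric_triangle (y m) (y m.+1) (y n.+1).
have T3 := metric_triangle (y m.+1) (y m) (y n.+1).
have T4 := metric_triangle (y m.+1) (y n.+1) (y n.+2).
have T5 := metric_triangle (y m.+1) (y n.+2) (y n.+1).
have T6 := metric_triangle (y m) (y n.+1) (y n.+2).
have S1 := metric_sym (y m.+1) (y m).
have S2 := metric_sym (y n.+2) (y n.+1).
have S3 := metric_sym (y n.+1) (y m.+1).
rewrite -?/(d _) in dn dm dn1 dm1 T1 T2 T3 T4 T5 T6 S1 S2 S3.
rewrite S1 S2 -?/(d _) in T3 T5.
apply: (gap (x m.+1) (x n.+2)).
- apply: orbit_Suzuki_pair; last lra.
  by move=> E; move: far; rewrite E mdistxx; lra.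
- rewrite -[mdist _ _]/(mdist (y m.+1) (y n.+2)) ltr_norml; lra.
have := M_max_ge_g f g (x m.+1) (x n.+2).
rewrite -!fg -[mdist _ _]/(mdist (y m) (y n.+1)) => geM.
have : M_max f g (x m.+1) (x n.+2) < e + delta.
  apply/M_max_lt; rewrite -!fg -!/(y _) -!/(d _) S3; split; lra.
by rewrite ltr_norml => *; lra.
Qed.

Lemma orbit_cauchy : cauchy (y @ \oo).
Proof.
apply: cauchy_exP => e e0; have [N HN] := orbit_cauchy_mdist e0.
exists (y N); exists N => // n Nn /=.
by rewrite ballEmdist; exact: HN.
Qed.

(** Suppose [f v <> g v] and let [l := d (g v) (f v)].  Among any two consecutive
    indices, one gives a Suzuki pair with [v]: otherwise [d (y n) (y n.+1)] would
    be at most half the sum of two consecutive steps, although the steps decrease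
    strictly.  For such a pair far out, both sides are close to [l]. *)
Lemma orbit_lim_coincidence {v : X} : y @ \oo --> g v -> f v = g v.
Proof.
move=> /metricType_numDomainType.cvgrPdist_lt ycvg; apply: contrapT => fgv.
have l0 : 0 < mdist (g v) (f v) by apply: mdist_neq_gt0 => /esym.
set l := mdist _ _ in l0; have [delta delta0 gap] := contr.2 l l0.
have [eta [eta0 eta_l eta_delta]] := exists_quarter_le l0 delta0.
have [N dN] := orbit_step_small eta0.
have [N' _ yN'] := ycvg _ eta0.
have yv n : (N' <= n)%N -> mdist (y n) (g v) < eta.
  by move=> /yN'; rewrite metric_sym.
have [n [Nn N'n half]] : exists n, [/\ (N <= n)%N, (N' <= n)%N &
    d n < 2 * mdist (y n) (g v)].
  pose n := maxn N N'.
  have [lt1|le1] := ltP (d n) (2 * mdist (y n) (g v)).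
    by exists n; rewrite leq_maxl leq_maxr.
  exists n.+1; rewrite !leqW ?leq_maxl ?leq_maxr //; split => //.
  have := metric_triangle (y n) (g v) (y n.+1).
  rewrite (metric_sym (g v)) -/(d n).
  by have := orbit_step_decreasing n; lra.
have dn := dN n Nn; have yn := yv n N'n; have yn1 := yv n.+1 (leqW N'n).
have T1 := metric_triangle (y n.+1) (g v) (f v).
have T2 := metric_triangle (g v) (y n.+1) (f v).
have T3 := metric_triangle (y n) (g v) (f v).
have S1 := metric_sym (g v) (y n.+1).
rewrite -?/l S1 in T1 T2 T3.
apply: (gap (x n.+1) v).
- split; rewrite -!fg -!/(y _) -?/(d _); last lra.
  by move=> E; move: half; rewrite E mdistxx; have := d_gt0 n; lra.
- by rewrite -/(y _) ltr_norml; lra.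
have := M_max_ge_gf f g (x n.+1) v; rewrite -/l => geM.
have : M_max f g (x n.+1) v < l + delta.
  by apply/M_max_lt; rewrite -!fg -!/(y _) -!/(d _) -/l S1; split; lra.
by rewrite ltr_norml => *; lra.
Qed.

End Jungck_orbit.

(** * Coincidence points *)

Lemma exists_Jungck_orbit {X : Type} {f g : X -> X} (x0 : X) :
  range f `<=` range g -> exists x : nat -> X, forall n, f (x n) = g (x n.+1).
Proof.
move=> fg; have pre u : exists w, f u = g w.
  by have [w _ <-] := fg (f u) (ex_intro2 _ _ u I erefl); exists w.
have [h hP] := choice pre.
by exists (fun n => iter n h x0) => n /=.
Qed.

Lemma exists_coincidence {R : realType} {X : metricType R} {f g : X -> X}
    (x0 : X) :
  gap_contraction f g -> range f `<=` range g ->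
  complete_subspace (range g) \/ complete_subspace (range f) ->
  exists v, f v = g v.
Proof.
move=> contr fg compl; have [x xP] := exists_Jungck_orbit x0 fg.
have [[n fxn]|neq] := pselect (exists n, f (x n) = f (x n.+1)).
  by exists (x n.+1); rewrite -fxn xP.
have {}neq n : f (x n) <> f (x n.+1) by move=> E; apply: neq; exists n.
have ycauchy := orbit_cauchy contr xP neq.
have [_ [v _ <-] ycvg] : exists2 l, range g l & (fun n => f (x n)) @ \oo --> l.
  case: compl => compl.
    by apply: compl ycauchy => n; exists (x n.+1) => //; rewrite xP.
  have [|l fl ycvg] := compl _ _ ycauchy; first by move=> n; exists (x n).
  by exists l => //; exact: fg.
by exists v; exact (orbit_lim_coincidence contr xP neq ycvg).
Qed.

Theorem theorem3p1 (R : realType) (G : R -> R -> R) (C : R)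
  (G_class : C_class G) (G_prop : property_CG G C)
  (X : metricType R) (X_nonempty : [set: X] !=set0) (f g : X -> X)
  (contr : Suzuki_generalized_contraction G C f g)
  (fX_sub_gX : range f `<=` range g)
  (compl : complete_subspace (range g) \/ complete_subspace (range f)) :
  exists! u : X, point_of_coincidence f g u.
Proof.
have gap := Suzuki_gap_contraction G_prop contr.
have [x0 _] := X_nonempty.
have [v fgv] := exists_coincidence x0 gap fX_sub_gX compl.
exists (g v); split=> [|_ [w [-> fgw]]]; first by exists v.
by rewrite fgw; exact (coincidence_value_unique gap fgv fgw).
Qed.
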